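(* Let $t \ge 1$ be an integer, and let $G$ be a finite digraph that is $t$-dispersed. For each vertex $v$, let $q_v = d^+(v)$ (the outdegree of $v$) if $v$ is not contained in any digon, and $q_v = d^+(v)-1$ otherwise. If $q = \min\{q_v \mid v \in V(G)\}$, then $c(G) > \frac{1}{e\,t}\,q^{t}$, where $c(G)$ is the cop number of the digraph $G$ and $e$ is the base of the natural logarithm.
   Context: Digraphs have no loops and no parallel edges, but may contain digons, i.e. pairs of oppositely directed edges $uv, vu$. Here $vu \in E(G)$ denotes the directed edge from $v$ to $u$, and $\mathrm{dist}(v,u)$ is the length of a shortest directed path from $v$ to $u$ ($\infty$ if there is none). Cops and robbers on a digraph $G$: the first player places each cop on a vertex (several cops may share a vertex), then the second player places one robber on a vertex. The players then alternate turns, the first player first: on her turn each cop stays at its vertex or moves along a directed edge to an out-neighbor; on his turn the robber stays or moves along a directed edge to an out-neighbor. The game has perfect information. The first player wins if at some point a cop occupies the robber's vertex; otherwise the second player wins. The cop number $c(G)$ is the least number of cops for which the first player has a winning strategy. A directed path from $v$ to $u$ is geodesic if its length equals $\mathrm{dist}(v,u)$. Two paths are internally disjoint if neither contains an internal vertex of the other. Write $\Vert P\Vert$ for the length of a path $P$. A $(v,u)$-trap is a subdigraph of $G$ consisting of two internally disjoint geodesic paths $P$ and $Q$, where $P$ is a directed $(v,x)$-path with at least one edge, $Q$ is a directed $(u,x)$-path, and $\Vert Q\Vert \le \Vert P\Vert$. The vertex $x$ is the tip of the trap and $\Vert P\Vert$ is the length of the trap. It is allowed that $u=x$ (so $Q$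 has length $0$). It is also allowed that $u=v$, but then $P$ and $Q$ are each required to have at least two edges. For an integer $t\ge 1$, $G$ is $t$-dispersed if: (1) for all $v,u \in V(G)$ with $v \ne u$, $G$ has no two internally disjoint $(v,u)$-traps (i.e. two distinct traps having no vertices in common other than $v$ and $u$), each of length at most $t$; (2) if $uv \in E(G)$, then $G$ has no $(v,u)$-trap of length at most $t$. *)

(* Defs.v *)
From mathcomp Require Import all_boot.
From mathcomp Require Import boolp.

Set Implicit Arguments.
Unset Strict Implicit.
Unset Printing Implicit Defensive.

(* As [arc] is a relation there are no parallel edges; digons are allowed. *)
Record digraph := Digraph {
  vertex :> finType;
  arc : rel vertex;
  arc_irr : irreflexive arc }.

Arguments arc {d}.

Definition outdeg (G : digraph) (v : G) : nat := #|[set w | arc v w]|.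

Definition in_digon (G : digraph) (v : G) : bool :=
  [exists u, arc v u && arc u v].

Definition qdeg (G : digraph) (v : G) : nat :=
  if in_digon v then outdeg v - 1 else outdeg v.

(* A directed path starting at [v] is given by the sequence [P] of its vertices
   other than [v]; thus its length is [size P]. *)
Definition dipath (G : digraph) (v : G) (P : seq G) (u : G) : bool :=
  [&& path arc v P, uniq (v :: P) & last v P == u].

Definition has_dipath (G : digraph) (v u : G) (n : nat) : bool :=
  [exists P : n.-tuple G, dipath v P u].

(* [None] stands for infinity. *)
Definition dist (G : digraph) (v u : G) : option nat :=
  if pselect (exists n, has_dipath v u n) is left ex_n
  then Some (ex_minn ex_n) else None.

Definition geodesic (G : digraph) (v : G) (P : seq G) (u : G) : bool :=
  dipath v P u && (dist v u == Some (size P)).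

Definition inner (G : digraph) (v : G) (P : seq G) : seq G :=
  behead (belast v P).

Definition internally_disjoint (G : digraph) (v : G) (P : seq G)
    (u : G) (Q : seq G) : bool :=
  ~~ has [in u :: Q] (inner v P) && ~~ has [in v :: P] (inner u Q).

(* Vertex set and arc set. *)
Definition subdigraph (G : digraph) : Type := ({set G} * {set G * G})%type.

Definition path_union (G : digraph) (v : G) (P : seq G) (u : G) (Q : seq G) :
    subdigraph G :=
  ([set w in (v :: P) ++ (u :: Q)],
   [set a in zip (belast v P) P ++ zip (belast u Q) Q]).

(* [trap v u l H]: the subdigraph [H] is a (v,u)-trap of length [l]. *)
Definition trap (G : digraph) (v u : G) (l : nat) (H : subdigraph G) : Prop :=
  exists (x : G) (P Q : seq G),
    [/\ geodesic v P x, geodesic u Q x & internally_disjoint v P u Q] /\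
    [/\ 0 < size P, size Q <= size P
      & u = v -> 1 < size P /\ 1 < size Q] /\
    [/\ size P = l & H = path_union v P u Q].

Definition disjoint_traps (G : digraph) (v u : G) (H1 H2 : subdigraph G) : Prop :=
  H1 <> H2 /\ H1.1 :&: H2.1 \subset [set v; u].

Definition dispersed (t : nat) (G : digraph) : Prop :=
  (forall v u : G, v <> u ->
     ~ exists (l1 l2 : nat) (H1 H2 : subdigraph G),
         [/\ trap v u l1 H1, trap v u l2 H2, l1 <= t, l2 <= t
           & disjoint_traps v u H1 H2]) /\
  (forall v u : G, arc u v ->
     ~ exists (l : nat) (H : subdigraph G), trap v u l H /\ l <= t).

Definition step (G : digraph) (v w : G) : bool := (w == v) || arc v w.

(* A strategy for [k] cops maps the list of the robber's positions so far, oldest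
   first, to the positions of the cops: [s [::]] is the initial placement, and
   [s (rcons h r)] is the answer once the robber, after history [h], is at [r].
   The cops' own past positions are values of [s] on prefixes. *)
Definition cop_strategy (G : digraph) (k : nat) : Type :=
  seq G -> {ffun 'I_k -> G}.

(* Legality is also required on histories that cannot occur or in which the
   robber was already caught; this is no restriction, as cops may stay put. *)
Definition legal (G : digraph) (k : nat) (s : cop_strategy G k) : Prop :=
  forall (h : seq G) (r : G) (i : 'I_k), step (s h i) (s (rcons h r) i).

Definition robber_play (G : digraph) (r : nat -> G) : Prop :=
  forall n, step (r n) (r n.+1).

(* The capture occurs either when the robber arrives at [r n], the cops having
   seen [r 0], ..., [r n.-1], or when the cops answer [r n]. *)
Definition captures (G : digraph) (k : nat) (s : cop_strategy G k)
    (r : nat -> G) : Prop :=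
  exists (n : nat) (i : 'I_k), s (mkseq r n) i = r n \/ s (mkseq r n.+1) i = r n.

Definition cops_win (G : digraph) (k : nat) : Prop :=
  exists s : cop_strategy G k,
    legal s /\ forall r : nat -> G, robber_play r -> captures s r.

Lemma cops_win_card (G : digraph) : exists k, `[< cops_win G k >].
Proof.
exists #|G|; apply/asboolP; exists (fun=> [ffun i => enum_val i]); split.
  by move=> h r i; rewrite /step eqxx.
by move=> r _; exists 0, (enum_rank (r 0)); left; rewrite ffunE enum_rankK.
Qed.

Definition cop_number (G : digraph) : nat := ex_minn (cops_win_card G).

(* Main.v *)
(* The robber keeps a potential small. If the robber moves from v to w, a cop at
   u <> v guards w if there is some x with d(v,x) = d(w,x) + 1 <= t and
   d(u,x) <= d(v,x). As G is t-dispersed, a cop guards at most one out-neighbor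
   of v, and none if it stands on an in-neighbor of v; in particular arcs from v
   to w increase by one the distance to every x with d(w,x) < t.
   A cop u with d(u,x) <= d(v,x) = i < t gets weight proportional to
   ((1 - 1/t) q)^(-i). On average over the out-neighbors w of v, a move of the
   robber multiplies these weights by at most 1 - 1/t, up to what a cop gains by
   coming from level t. Hence fewer than (1 - 1/t)^(t - 1) q^t / t cops never
   reach level 0, and (1 - 1/t)^(t - 1) > 1/e. The initial position is found from
   a minimizer of the potential: the same average estimate with standing cops
   shows that the minimum is small. *)
Require Import Defs.
From mathcomp Require Import all_boot all_order all_algebra.
From mathcomp Require Import all_classical all_reals all_analysis.
From mathcomp Require Import zify ring.
Import Order.TTheory GRing.Theory Num.Theory.

Set Implicit Arguments.
Unset Strict Implicit.
Unset Printing Implicit Defensive.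

(* [arc] is also a function of [mathcomp.boot.path]. *)
Local Notation arc := Defs.arc.

(** * Walks, distances and shortest paths *)

Section Distance.
Variable G : digraph.
Implicit Types (u v w x z : G) (P Q A B C D : seq G) (n m : nat).

(** Encodes dist(v,x) <= n: as [step] allows staying put, all walks of length at most [n] count. *)
Fixpoint reach n v x : bool :=
  if n is m.+1 then [exists w, step v w && reach m w x] else v == x.

Lemma reachS n v x : reach n v x -> reach n.+1 v x.
Proof. by move=> h; apply/existsP; exists v; rewrite /step eqxx. Qed.

Lemma reach_leq m n v x : m <= n -> reach m v x -> reach n v x.
Proof.
by move/subnK <-; elim: (n - m) => // d IH /IH; rewrite addSn; apply: reachS.
Qed.

Lemma reach_path v P : path arc v P -> reach (size P) v (last v P).
Proof.
elim: P v => [v _|w P IH v] /=; first exact: eqxx.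
by case/andP=> vw /IH h; apply/existsP; exists w; rewrite /step vw orbT.
Qed.

Definition shortest v P : Prop :=
  path arc v P /\ forall m, reach m v (last v P) -> size P <= m.

Lemma reach_shortest n v x :
  reach n v x -> exists P, [/\ shortest v P, last v P = x & size P <= n].
Proof.
move=> h; have ex : exists n, reach n v x by exists n.
case: (ex_minnP ex) => m hm mmin.
have [P [hP eP sP]] : exists P, [/\ path arc v P, last v P = x & size P <= m].
  elim: m v hm {mmin ex h} => [v /eqP -> | m IH v /=]; first by exists [::].
  case/existsP=> w /andP[/orP[/eqP -> | vw] /IH [P [hP eP sP]]].
    by exists P; rewrite hP (leq_trans sP).
  by exists (w :: P); rewrite /= vw.
exists P; split=> //; last exact: leq_trans sP (mmin _ h).
by split=> // k; rewrite eP => /mmin; apply: leq_trans.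
Qed.

(** A shorter walk in place of either piece would shorten the whole path. *)
Lemma shortest_cat v A B :
  shortest v (A ++ B) -> shortest v A /\ shortest (last v A) B.
Proof.
rewrite /shortest cat_path last_cat size_cat => -[/andP[pA pB] hmin].
split; split=> // m.
  case/reach_shortest=> A' [[pA' _] eA' sA'].
  have := hmin (size A' + size B).
  rewrite -eA' -last_cat -size_cat in pB *.
  have pp : path arc v (A' ++ B) by rewrite cat_path pA'.
  by move/(_ (reach_path pp)); rewrite size_cat; lia.
case/reach_shortest=> B' [[pB' _] eB' sB'].
have pp : path arc v (A ++ B') by rewrite cat_path pA.
have := hmin (size A + size B'); rewrite -eB' -last_cat -size_cat.
by move/(_ (reach_path pp)); rewrite size_cat; lia.
Qed.

Lemma shortest_uniq v P : shortest v P -> uniq (v :: P).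
Proof.
case=> pP; case/shortenP: (pP) => P' pP' uP' sub hmin.
have := hmin _ (reach_path pP').
move=> hs; rewrite (leq_size_uniq uP') //= => z; rewrite !inE.
by case/orP=> [-> // | /sub ->]; rewrite orbT.
Qed.

Lemma shortest_geodesic v P : shortest v P -> geodesic v P (last v P).
Proof.
move=> hP; have [pP hmin] := hP; have uP := shortest_uniq hP.
have dP : dipath v P (last v P) by rewrite /dipath pP uP eqxx.
rewrite /geodesic dP /= /dist; case: pselect => [ex_n | []]; last first.
  by exists (size P); apply/existsP; exists (in_tuple P).
case: ex_minnP => m /existsP[Q /and3P[pQ _ /eqP eQ]] mmin.
apply/eqP; congr Some; apply/eqP; rewrite eqn_leq mmin; last first.
  by apply/existsP; exists (in_tuple P).
have := hmin (size Q); rewrite -eQ size_tuple; apply.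
by rewrite -[X in reach X](size_tuple Q) reach_path.
Qed.

Lemma mem_inner v P z :
  uniq (v :: P) -> z \in inner v P -> z \in P /\ z <> last v P.
Proof.
rewrite /inner; case/lastP: P => // P y.
rewrite belast_rcons last_rcons /= rcons_uniq => /and3P[_ yP _] zP.
by split=> [|ezy]; [rewrite mem_rcons inE zP orbT | rewrite -ezy zP in yP].
Qed.

Lemma in_split v P z :
  z \in v :: P -> exists A B, P = A ++ B /\ last v A = z.
Proof. by case/splitPl => A B e; exists A, B. Qed.

End Distance.

(** * Traps in a dispersed digraph *)

Section Traps.
Variables (G : digraph) (t : nat).
Implicit Types (u v w x z : G) (P Q A B C D : seq G).

(** A trap of length at most [t] without internal disjointness, which [pretrap_reduce] restores. *)
Definition pretrap v u P Q : Prop :=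
  [/\ shortest v P, shortest u Q, last v P = last u Q
    & [/\ size Q <= size P, 0 < size P & size P <= t]].

(** Following [A] and then [D] leads from [v] to the tip, so it is at least as long as [P], hence as
    [Q], which is [C] followed by [D]. *)
Lemma pretrap_prefix v u P Q A C D :
  pretrap v u P Q -> Q = C ++ D -> path arc v A -> last v A = last u C ->
  size C <= size A.
Proof.
case=> [[_ hP]] [pQ _] e [sQP _ _] eQ pA eA; subst Q.
move: pQ e; rewrite cat_path last_cat -eA => /andP[_ pD] e.
have pAD : path arc v (A ++ D) by rewrite cat_path pA.
have := reach_path pAD; rewrite last_cat -e => /hP.
by move: sQP; rewrite !size_cat; lia.
Qed.

Lemma pretrap_notin v u P Q : u <> v -> pretrap v u P Q -> v \notin u :: Q.
Proof.
move=> uv h; apply/negP => /in_split[C [D [eQ eC]]].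
have := pretrap_prefix (A := [::]) h eQ isT (esym eC).
by rewrite leqn0 size_eq0 => /eqP eC0; rewrite eC0 in eC.
Qed.

(** The length condition survives by [pretrap_prefix]; [A] is nonempty because [v] is not on [Q], so
    the first arc survives too. *)
Lemma pretrap_shorten v u P Q A B C D :
  u <> v -> pretrap v u P Q -> P = A ++ B -> Q = C ++ D ->
  last v A = last u C ->
  pretrap v u A C /\ head v A = head v P.
Proof.
move=> uv h eP eQ e; have vQ := pretrap_notin uv h.
have [hP hQ _ [_ sP Pt]] := h; rewrite eP in hP; rewrite eQ in hQ.
have [[hA hB] [hC hD]] := (shortest_cat hP, shortest_cat hQ).
have A0 : A != [::].
  apply/eqP => A0; move: e vQ; rewrite A0 /= => e.
  by rewrite [X in X \in _]e eQ -cat_cons mem_cat mem_last.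
split; last by rewrite eP; case: (A) A0.
split=> //; split; last by move: Pt; rewrite eP size_cat; lia.
  exact: pretrap_prefix h eQ (proj1 hA) e.
by case: (A) A0.
Qed.

(** Cut at a common vertex other than the tip while there is one; each cut shortens [P]. *)
Lemma pretrap_reduce v u P Q :
  u <> v -> pretrap v u P Q ->
  exists P' Q', [/\ pretrap v u P' Q', head v P' = head v P,
    size P' <= size P, size Q' <= size Q
    & forall z, z \in P' -> z \in u :: Q' -> z = last v P'].
Proof.
move=> uv; have [n] := ubnP (size P).
elim: n P Q => // n IH P Q sP h.
have [/allP hz | /allPn[z zP]] :=
  boolP (all (fun z => (z \in u :: Q) ==> (z == last v P)) P).
  exists P, Q; split=> // z zP zQ.
  by apply/eqP; have := hz _ zP; rewrite zQ.
rewrite negb_imply => /andP[zQ zlast].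
have [A [B [eP eA]]] : exists A B, P = A ++ B /\ last v A = z.
  by apply: in_split; rewrite inE zP orbT.
have [C [D [eQ eC]]] := in_split zQ.
have [hAC hd] := pretrap_shorten uv h eP eQ (etrans eA (esym eC)).
have B0 : 0 < size B.
  by case: B eP => // eP; move: zlast; rewrite eP cats0 eA eqxx.
have sAP : size A < size P by rewrite eP size_cat; lia.
have [|P' [Q' [h' hd' sP' sQ' hz]]] := IH A C _ hAC; first lia.
exists P', Q'; split=> //; first by rewrite hd'.
  by apply: leq_trans sP' _; rewrite ltnW.
by apply: leq_trans sQ' _; rewrite eQ size_cat leq_addr.
Qed.

Lemma pretrap_trap v u P Q :
  u <> v -> pretrap v u P Q ->
  (forall z, z \in P -> z \in u :: Q -> z = last v P) ->
  trap v u (size P) (path_union v P u Q).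
Proof.
move=> uv h hz; have vQ := pretrap_notin uv h.
have [hP hQ e [sQP sP Pt]] := h.
exists (last v P), P, Q; split; last by split.
split; first exact: shortest_geodesic.
  by rewrite e; apply: shortest_geodesic.
apply/andP; split; apply/hasPn => z.
  move=> /(mem_inner (shortest_uniq hP))[zP zl] /=.
  by apply/negP => /(hz _ zP).
move=> /(mem_inner (shortest_uniq hQ))[zQ zl] /=.
have zuQ : z \in u :: Q by rewrite inE zQ orbT.
rewrite inE; apply/norP; split; first by apply: contraNneq vQ => <-.
by apply/negP => zP; apply: zl; rewrite -e; apply: hz.
Qed.

Hypothesis hG : dispersed t G.

Lemma no_pretrap_behind v u P Q : arc u v -> ~ pretrap v u P Q.
Proof.
move=> uv h; have neq : u <> v by move=> e; rewrite e arc_irr in uv.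
have [P' [Q' [h' _ _ _ hz]]] := pretrap_reduce neq h.
apply: (proj2 hG v u uv); exists (size P'), (path_union v P' u Q').
by split; [apply: pretrap_trap | case: h' => _ _ _ []].
Qed.

Lemma path_notin v P : shortest v P -> v \notin P.
Proof. by move/shortest_uniq => /andP[]. Qed.

(* Two minimal pretraps with distinct first arcs can only meet in [v] and [u],
   since a further common vertex [z] gives a smaller such pair, for [u] or for
   [z] in the place of [u]. *)
Lemma pretrap_head v u P1 Q1 P2 Q2 :
  u <> v -> pretrap v u P1 Q1 -> pretrap v u P2 Q2 -> head v P1 = head v P2.
Proof.
have [n] := ubnP (size P1 + size Q1 + size P2 + size Q2).
elim: n u P1 Q1 P2 Q2 => // n IH u P1 Q1 P2 Q2 hn uv h1 h2.
have [P1' [Q1' [h1' <- sP1 sQ1 hz1]]] := pretrap_reduce uv h1.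
have [P2' [Q2' [h2' <- sP2 sQ2 hz2]]] := pretrap_reduce uv h2.
have {hn sP1 sQ1 sP2 sQ2} : size P1' + size Q1' + size P2' + size Q2' < n.+1.
  lia.
move: P1' Q1' P2' Q2' h1' h2' hz1 hz2 {h1 h2} => {}P1 {}Q1 {}P2 {}Q2.
move=> h1 h2 hz1 hz2 hn.
apply/eqP/negPn/negP => /eqP hd.
have vQ1 := pretrap_notin uv h1; have vQ2 := pretrap_notin uv h2.
(* Otherwise put [z] in the place of [u] and keep only the tails of [Q1] and [Q2] from [z]. *)
have QQ z : z \in Q1 -> z \notin Q2.
  move=> zQ1; apply/negP => zQ2; apply: hd.
  have [hP1 hQ1 e1 [sQP1 sP1 P1t]] := h1; have [hP2 hQ2 e2 [sQP2 sP2 P2t]] := h2.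
  have [|C1 [D1 [eQ1 eC1]]] := @in_split _ u Q1 z; first by rewrite inE zQ1 orbT.
  have [|C2 [D2 [eQ2 eC2]]] := @in_split _ u Q2 z; first by rewrite inE zQ2 orbT.
  have zv : z <> v by move=> e; move: vQ1; rewrite -e inE zQ1 orbT.
  have C1n : 0 < size C1.
    case: (C1) eC1 => //= e; have := path_notin hQ1; by rewrite e zQ1.
  rewrite eQ1 in hQ1 e1 sQP1 hn; rewrite eQ2 in hQ2 e2 sQP2 hn.
  move: e1 e2 sQP1 sQP2 hn; rewrite !last_cat !size_cat eC1 eC2 => *.
  apply: (IH z P1 D1 P2 D2) => //; first lia.
    by split=> //; [case: (shortest_cat hQ1); rewrite eC1 | split=> //; lia].
  by split=> //; [case: (shortest_cat hQ2); rewrite eC2 | split=> //; lia].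
(* Here [z] replaces [u]: [P] is paired with the tail of [Q], and the part of [P'] up to [z] with
   the empty path. The generic form serves both orders of the pretraps. *)
have PQ P Q P' Q' z : size P + size Q + size P' + size Q' < n.+1 ->
    pretrap v u P Q -> pretrap v u P' Q' -> head v P <> head v P' ->
    z \in P' -> z \in u :: Q -> z = u.
  move=> {}hn h h' {}hd zP' zQ; apply/eqP/negPn/negP => /eqP zu; apply: hd.
  have vQ := pretrap_notin uv h.
  have zv : z <> v by move=> e; rewrite -e zQ in vQ.
  have [C [D [eQ eC]]] := in_split zQ.
  have [|A [B [eP' eA]]] := @in_split _ v P' z; first by rewrite inE zP' orbT.
  have [hP hQ e [sQP sP Pt]] := h; have [hP' _ _ [_ _ Pt']] := h'.
  have Cn : 0 < size C by case: (C) eC => //= e'; case: zu.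
  have An : 0 < size A by case: (A) eA => //= e'; case: zv.
  have <- : head v A = head v P' by rewrite eP'; case: (A) An.
  rewrite eQ in hQ e sQP hn; rewrite eP' in hP' Pt' hn.
  move: e sQP hn Pt'; rewrite last_cat !size_cat eC => *.
  apply: (IH z P D A [::]) => //=; first lia.
    by split=> //; [case: (shortest_cat hQ); rewrite eC | split=> //; lia].
  by split=> //; [case: (shortest_cat hP') | split=> //; lia].
have PP z : z \in P1 -> z \in P2 -> z = u.
  move=> zP1 zP2; apply/eqP/negPn/negP => /eqP zu; apply: hd.
  have [hP1 hQ1 e1 [sQP1 sP1 P1t]] := h1; have [hP2 hQ2 e2 [sQP2 sP2 P2t]] := h2.
  have [|A1 [B1 [eP1 eA1]]] := @in_split _ v P1 z; first by rewrite inE zP1 orbT.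
  have [|A2 [B2 [eP2 eA2]]] := @in_split _ v P2 z; first by rewrite inE zP2 orbT.
  have zv : z <> v by move=> e; move: (path_notin hP1); rewrite -e zP1.
  have A1n : 0 < size A1 by case: (A1) eA1 => //= e'; case: zv.
  have A2n : 0 < size A2 by case: (A2) eA2 => //= e'; case: zv.
  (* If [B1] and [Q1] were both empty, the first tip would be [z] and also [u]. *)
  have dec : size A1 + 0 + size A2 + 0 < n.
    have : 0 < size B1 + size Q1.
      rewrite addn_gt0 !lt0n !size_eq0; apply/orP.
      case: eqP => [B0|]; last by left.
      right; apply/eqP => Q0; apply: zu.
      by rewrite -eA1 -[A1]cats0 -B0 -eP1 e1 Q0.
    by move: hn; rewrite eP1 eP2 !size_cat; lia.
  have -> : head v P1 = head v A1 by rewrite eP1; case: (A1) A1n.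
  have -> : head v P2 = head v A2 by rewrite eP2; case: (A2) A2n.
  apply: (IH z A1 [::] A2 [::]) => //.
    rewrite eP1 in hP1 P1t; split=> //; first by case: (shortest_cat hP1).
    by move: P1t; rewrite size_cat; split=> //; lia.
  rewrite eP2 in hP2 P2t; split=> //; first by case: (shortest_cat hP2).
  by move: P2t; rewrite size_cat; split=> //; lia.
have hn' : size P2 + size Q2 + size P1 + size Q1 < n.+1 by lia.
have meet : (path_union v P1 u Q1).1 :&: (path_union v P2 u Q2).1
    \subset [set v; u].
  apply/fintype.subsetP => z; rewrite !inE !mem_cat !inE.
  case: (z =P v) => //= _; case: (z =P u) => //= zu.
  case/andP=> /orP[z1|z1] /orP[z2|z2].
  - by case: zu; apply: PP.
  - by case: zu; apply: (PQ _ _ _ _ z hn' h2 h1) => //;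
      [apply: nesym | rewrite inE z2 orbT].
  - by case: zu; apply: (PQ _ _ _ _ z hn h1 h2) => //; rewrite inE z1 orbT.
  - by move: (QQ _ z1); rewrite z2.
apply: (proj1 hG v u (nesym uv)).
exists (size P1), (size P2), (path_union v P1 u Q1), (path_union v P2 u Q2).
split; [exact: pretrap_trap | exact: pretrap_trap | | | ].
- by case: h1 => _ _ _ [].
- by case: h2 => _ _ _ [].
split=> // eH; apply: hd.
(* The two traps must also be distinct: if they were equal, all their vertices would be [v] or [u],
   so both first arcs would lead to [u]. *)
have hdP P Q : pretrap v u P Q ->
  (path_union v P u Q).1 \subset [set v; u] -> head v P = u.
  case=> hP _ _ [_ sP _] /fintype.subsetP/(_ (head v P)).
  case: P hP sP => // w P hP _; rewrite !inE eqxx orbT => /(_ isT).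
  by case/orP=> [/eqP e|/eqP //]; move: (path_notin hP); rewrite /= -e inE eqxx.
by rewrite (hdP _ _ h1) ?(hdP _ _ h2) //; move: meet; rewrite eH finset.setIid.
Qed.

End Traps.

(** * Out-neighbors guarded by a cop *)

Section Guards.
Variables (G : digraph) (t : nat).
Hypothesis hG : dispersed t G.
Implicit Types (u v w x : G) (i j : nat).

Definition at_distance i v x : bool :=
  reach i v x && ((i == 0) || ~~ reach i.-1 v x).

(* [j = 0] on the robber's turn and [j = 1] on the cops' turn. *)
Definition guards j i v u : bool :=
  [exists x, at_distance i v x && reach (i + j) u x].

Lemma at_distance_shortest i v x :
  at_distance i v x -> exists P, [/\ shortest v P, last v P = x & size P = i].
Proof.
case/andP=> /reach_shortest[P [hP eP sP]] hi; exists P; split=> //.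
apply/eqP; rewrite eqn_leq sP leqNgt; apply/negP => lt.
case/orP: hi => [/eqP i0|]; first by rewrite i0 in lt.
case: i lt {sP} => //= i lt; apply/negP/negPn.
by apply: (@reach_leq _ (size P)); rewrite // -eP; apply: reach_path; case: hP.
Qed.

(** Otherwise a path of length at most [i] from [v] to [x] yields a pretrap from [w] against its
    in-neighbor [v]. *)
Lemma at_distanceS i v w x :
  arc v w -> i < t -> at_distance i w x -> at_distance i.+1 v x.
Proof.
move=> vw it hx; apply/andP; split.
  by apply/existsP; exists w; rewrite /step vw orbT; case/andP: hx.
apply/negP => /= /reach_shortest[Q [hQ eQ sQ]].
have [P [hP eP sP]] := at_distance_shortest hx.
case: P hP eP sP => [|y P] hP eP sP.
  move: sQ eQ; rewrite -sP /= leqn0 size_eq0 => /eqP -> /= e.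
  by move: vw; rewrite e -eP /= arc_irr.
apply: (no_pretrap_behind hG (P := y :: P) (Q := Q) vw); split=> //; first by rewrite eP.
by rewrite sP; split=> //; [rewrite -sP | exact: ltnW].
Qed.

Lemma guards_step i v w u :
  arc v w -> i < t -> guards 1 i w u -> guards 0 i.+1 v u.
Proof.
move=> vw it /existsP[x /andP[hx ux]]; apply/existsP; exists x.
by rewrite (at_distanceS vw it hx) addn0 -addn1.
Qed.

(** Guarding [w] yields a pretrap from [v] against [u], of length i + 1 <= t, whose first arc leads
    to [w]; [pretrap_head] compares the first arcs. *)
Lemma guards_inj i v u w1 w2 : u <> v -> i < t ->
  arc v w1 -> arc v w2 -> guards 1 i w1 u -> guards 1 i w2 u -> w1 = w2.
Proof.
move=> uv it.
have first_step w : arc v w -> guards 1 i w u ->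
    exists P Q, pretrap t v u P Q /\ head v P = w.
  move=> vw /existsP[x /andP[hx]]; rewrite addn1.
  case/reach_shortest=> Q [hQ eQ sQ].
  have [P [[pP _] eP sP]] := at_distance_shortest hx.
  have /andP[_ /= /negP far] := at_distanceS vw it hx.
  exists (w :: P), Q; split=> //; split=> //=; rewrite ?eP ?sP //.
  split=> [/=|m /= hm]; first by rewrite vw.
  rewrite sP ltnNge; apply/negP => mi; apply: far.
  by rewrite -eP; apply: reach_leq hm.
move=> vw1 vw2 /(first_step _ vw1)[P1 [Q1 [h1 <-]]] /(first_step _ vw2)[P2 [Q2 [h2 <-]]].
exact: pretrap_head hG _ _ _ _ _ _ uv h1 h2.
Qed.

Lemma sum_guards1 i v u : u <> v -> i < t ->
  \sum_(w | arc v w) guards 1 i w u <= guards 0 i.+1 v u.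
Proof.
move=> uv it.
have [w /andP[vw gw]|none] := pickP [pred w | arc v w && guards 1 i w u].
  rewrite (bigD1 w) //= gw big1 => [|w' /andP[vw' /eqP ne]].
    by rewrite (guards_step vw it gw).
  case g: (guards 1 i w' u) => //; case: ne.
  exact: guards_inj uv it vw' vw g gw.
by rewrite big1 // => w vw; have := none w; rewrite /= vw /= => ->.
Qed.

Lemma guards01 i w u : guards 0 i w u -> guards 1 i w u.
Proof.
move=> /existsP[x /andP[hx ux]]; apply/existsP; exists x.
by rewrite hx (reach_leq _ ux) // leq_add2l.
Qed.

(** Here the cop may stand on [v]; it is then at distance i + 1 from each relevant [x], and all
    terms vanish. *)
Lemma sum_guards0 i v u : i < t ->
  \sum_(w | arc v w) guards 0 i w u <= guards 0 i.+1 v u.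
Proof.
move=> it; have [-> | /eqP uv] := eqVneq u v.
  rewrite big1 // => w vw; apply/eqP; rewrite eqb0; apply/existsP => -[x].
  rewrite addn0 => /andP[/(at_distanceS vw it)/andP[_ /= /negP far] near].
  exact: far.
apply: leq_trans (sum_guards1 uv it); apply: leq_sum => w _.
by have := @guards01 i w u; do 2!case: guards => // /(_ isT).
Qed.

Lemma guards_move j i v u u' : step u u' -> guards j i v u' -> guards j.+1 i v u.
Proof.
move=> uu /existsP[x /andP[hx ux]]; apply/existsP; exists x.
by rewrite hx addnS; apply/existsP; exists u'; rewrite uu.
Qed.

Lemma guards0_reach j v u : guards j 0 v u = reach j u v.
Proof.
apply/existsP/idP => [[x /andP[/andP[/eqP -> _]]] // | h].
by exists v; rewrite /at_distance /= eqxx.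
Qed.

End Guards.

Section Potential.
Variables (G : digraph) (s q k : nat).
Local Notation t := s.+1.
Hypothesis hG : dispersed t G.
Hypothesis hq : forall v : G, q <= outdeg v.
(** This is k < (1 - 1/t)^(t - 1) q^t / t without denominators. *)
Hypothesis hk : k * t ^ t < s ^ s * q ^ t.
Implicit Types (v w : G) (c : {ffun 'I_k -> G}).

(* Up to normalization [weight i] is ((1 - 1/t) q)^(-i): each level is worth
   (1 - 1/t) q times the next one. *)
Definition weight i := (s * q) ^ (s - i) * t ^ i.

Definition potential j v c :=
  \sum_(a < k) \sum_(i < t) weight i * guards j i v (c a).

(** As t * weight i = s * q * weight (i + 1), level i + 1 at [v] pays for level i at all [w]
    together. *)
Lemma potential_step j v c :
  (forall a i, i < t ->
    \sum_(w | arc v w) guards j i w (c a) <= guards 0 i.+1 v (c a)) ->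
  t * \sum_(w | arc v w) potential j w c <= s * q * potential 0 v c + k * t ^ t.
Proof.
move=> hsum; rewrite /potential exchange_big /= !big_distrr /=.
have -> : k * t ^ t = \sum_(a < k) t ^ t by rewrite sum_nat_const card_ord.
rewrite -big_split /=; apply: leq_sum => a _.
rewrite exchange_big /=.
have bound i : i < t -> \sum_(w | arc v w) weight i * guards j i w (c a) <=
    weight i * guards 0 i.+1 v (c a).
  by move=> it; rewrite -big_distrr leq_mul2l hsum ?orbT.
apply: (@leq_trans (t * \sum_(i < t) weight i * guards 0 i.+1 v (c a))).
  by rewrite leq_mul2l; apply/orP; right; apply: leq_sum => i _; apply: bound.
(* The level i = s would be paid by level [t], which is outside the potential; it costs at most t^t
   per cop. *)
rewrite big_ord_recr /= mulnDr; apply: leq_add; last first.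
  by rewrite /weight subnn expn0 mul1n mulnA -expnS -[leqRHS]muln1
    leq_mul ?leq_b1.
rewrite big_ord_recl /= mulnDr -[leqLHS]add0n leq_add // !big_distrr /=.
apply: leq_sum => i _; rewrite /bump /= add1n !mulnA leq_mul2r.
apply/orP; right; rewrite /weight -(subnSK (ltn_ord i)) expnS expnS.
by apply/eq_leq; ring.
Qed.

(** If every out-neighbor had potential at least [b], then t q b <= s q b + k t^t < s q b + q b,
    since k t^t < q * weight 0 <= q b. *)
Lemma potential_lt_next j v c b : potential 0 v c <= b -> weight 0 <= b ->
  t * \sum_(w | arc v w) potential j w c <= s * q * potential 0 v c + k * t ^ t ->
  exists2 w, arc v w & potential j w c < b.
Proof.
move=> hv hb hsum.
have [w /andP[vw hw]|none] := pickP [pred w | arc v w && (potential j w c < b)].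
  by exists w.
have lo : q * b <= \sum_(w | arc v w) potential j w c.
  apply: (@leq_trans (\sum_(w | arc v w) b)).
    rewrite sum_nat_const leq_mul2r; apply/orP; right.
    by apply: leq_trans (hq v) _; rewrite /outdeg cardsE.
  by apply: leq_sum => w vw; move/negbT: (none w); rewrite /= vw /= -leqNgt.
have : t * (q * b) < t * (q * b).
  apply: leq_ltn_trans (leq_trans _ hsum) _; first by rewrite leq_mul2l lo orbT.
  rewrite [ltnRHS]mulSn [ltnRHS]addnC -addnS leq_add //.
    by rewrite mulnA leq_mul2l hv orbT.
  apply: leq_trans hk _; apply: leq_trans (_ : q * weight 0 <= _).
    by rewrite /weight subn0 expn0 muln1 expnMn expnS; apply/eq_leq; ring.
  by rewrite leq_mul2l hb orbT.
by rewrite ltnn.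
Qed.

Lemma exists_small_potential c (v0 : G) : exists v, potential 0 v c < weight 0.
Proof.
have [v _ vmin] := @arg_minnP G v0 xpredT (fun v => potential 0 v c) isT.
exists v; rewrite ltnNge; apply/negP => hv.
(* With the minimum itself as [b], some out-neighbor would lie below it. *)
have [w _] := @potential_lt_next 0 v c (potential 0 v c) (leqnn _) hv
  (potential_step (fun a i it => sum_guards0 hG v (c a) it)).
by rewrite ltnNge vmin.
Qed.

Lemma potential_small j v c : potential j v c < weight 0 ->
  forall a, ~~ reach j (c a) v.
Proof.
move=> h a; rewrite -guards0_reach; apply/negP => g; move: h; rewrite ltnNge.
rewrite /potential (bigD1 a) //= big_ord_recl /= g muln1 -addnA.
by rewrite leq_addr.
Qed.

Lemma robber_move v c : potential 0 v c < weight 0 ->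
  exists2 w, arc v w & potential 1 w c < weight 0.
Proof.
move=> h; apply: (potential_lt_next (ltnW h) (leqnn _)).
(* A small potential keeps every cop off [v], as [sum_guards1] requires. *)
apply: potential_step => a i it; apply: (sum_guards1 hG) => // e.
by move/negP: (potential_small h a); rewrite e; apply; apply: eqxx.
Qed.

Lemma cops_move w c c' : (forall a, step (c a) (c' a)) ->
  potential 0 w c' <= potential 1 w c.
Proof.
move=> hc; apply: leq_sum => a _; apply: leq_sum => i _.
rewrite leq_mul2l; apply/orP; right.
by have := @guards_move _ 0 i w _ _ (hc a); do 2!case: guards => // /(_ isT).
Qed.

Lemma cops_lose : G -> ~ cops_win G k.
Proof.
move=> v0 [st [legal_st win]].
pose small w c := potential 1 w c < weight 0.
(* The vertex [v] is an imagined earlier position: the robber starts at [w0], with the cops about to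
   move. *)
have [v /robber_move[w0 _ hw0]] := exists_small_potential (st [::]) v0.
(* The default [v] keeps every answer legal; by [inv] the pick succeeds throughout the play. *)
pose next v c := odflt v [pick w | arc v w && small w c].
pose answer h := if h is x :: h' then next (last x h') (st h) else w0.
pose hist n := iter n (fun h => rcons h (answer h)) [::].
pose r n := answer (hist n).
have histS n : hist n.+1 = rcons (hist n) (r n) by [].
have histE n : mkseq r n = hist n by elim: n => // n IH; rewrite mkseqS IH.
have rS n : r n.+1 = next (r n) (st (hist n.+1)).
  rewrite {1}/r histS /answer.
  by case: (hist n) => //= x h; rewrite last_rcons.
have inv n : small (r n) (st (hist n)).
  elim: n => [|n IH]; first exact: hw0.
  have legal_n a : step (st (hist n) a) (st (hist n.+1) a) by exact: legal_st.
  have [w vw hw] := robber_move (leq_ltn_trans (cops_move (r n) legal_n) IH).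
  rewrite rS /next; case: pickP => [x /andP[] // |/(_ w)].
  by rewrite vw /small hw.
have play : robber_play r.
  move=> n; rewrite rS /next; case: pickP => [x /andP[vx _]|_].
    by rewrite /step vx orbT.
  by rewrite /step eqxx.
have [n [i]] := win r play; rewrite !histE.
have /negP far := potential_small (inv n) i.
(* Whether the robber runs into a cop or a cop moves onto him, that cop was within one step of
   [r n]. *)
case=> e; apply: far; apply/existsP.
  by exists (r n); rewrite -e /step /= !eqxx.
by exists (st (hist n.+1) i); rewrite legal_st /= e eqxx.
Qed.

End Potential.

(** * Passage to the cop number and to the constant [e] *)

Lemma dispersed_qdeg (G : digraph) (t : nat) (v : G) :
  1 <= t -> dispersed t G -> qdeg v = outdeg v.
Proof.
move=> t1 hG; rewrite /qdeg /in_digon; case: existsP => // -[u /andP[vu uv]].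
have vNu : v != u by apply: contraTneq vu => ->; rewrite arc_irr.
(* A digon is excluded: its arc from [v] to [u] and the empty path at [u] form a pretrap of length 1
   against the in-neighbor [u]. *)
case: (no_pretrap_behind hG (P := [:: u]) (Q := [::]) uv); split=> //.
split=> [/=|[|m] //]; first by rewrite vu.
by move=> /= /eqP e; rewrite e eqxx in vNu.
Qed.

Lemma cop_number_gt0 (G : digraph) : G -> 0 < cop_number G.
Proof.
move=> v0; rewrite /cop_number; case: ex_minnP => -[|n] // /asboolP[st [_ win]].
by have [|n [[]]] := win (fun=> v0); first by move=> n; rewrite /step eqxx.
Qed.

Lemma cop_number_win (G : digraph) : cops_win G (cop_number G).
Proof. by rewrite /cop_number; case: ex_minnP => n /asboolP. Qed.

Local Open Scope ring_scope.

(** For s > 0 this is the s-th power of 1 + 1/s < exp(1/s). *)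
Lemma expS_lt_expR1 (R : realType) (s : nat) :
  s.+1%:R ^+ s < expR 1 * s%:R ^+ s :> R.
Proof.
case: s => [|s]; first by rewrite !expr0 mulr1 -expR0 ltr_expR.
have s0 : 0 < s.+1%:R :> R by rewrite ltr0n.
have -> : expR 1 = expR (s.+1%:R^-1) ^+ s.+1 :> R.
  by rewrite -expRM_natl mulfV ?gt_eqF.
rewrite -exprMn ltrXn2r //.
rewrite -ltr_pdivrMr // -natr1 mulrDl mul1r divff ?gt_eqF //.
by rewrite expR_gt1Dx // invr_eq0 gt_eqF.
Qed.

Theorem theorem3p5 (R : realType) (t : nat) (G : digraph) (q : nat)
  (ht : (1 <= t)%N) (hG : dispersed t G)
  (hq_attained : exists v : G, qdeg v = q)
  (hq_lower : forall v : G, (q <= qdeg v)%N) :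
  1 / (expR 1 * t%:R) * q%:R ^+ t < (cop_number G)%:R :> R.
Proof.
case: hq_attained => v0 _.
have [q0 | q_gt0] := posnP q.
  by rewrite q0 expr0n gtn_eqF // mulr0 ltr0n cop_number_gt0.
case: t ht hG => // s _ hG; rewrite ltNge; apply/negP => le_c.
have hq (v : G) : (q <= outdeg v)%N by rewrite -(dispersed_qdeg v (ltn0Sn s) hG).
apply: (cops_lose hG hq _ v0 (cop_number_win G)).
rewrite -(ltr_nat R) !natrM !natrX.
have e0 : 0 < expR 1 * s.+1%:R :> R by rewrite mulr_gt0 ?expR_gt0 ?ltr0n.
rewrite mul1r mulrC ler_pdivlMr // in le_c.
have q0 : 0 < q%:R ^+ s.+1 :> R by rewrite exprn_gt0 ?ltr0n.
(* With c the cop number, c e t <= q^t gives e c t^t = t^s (c e t) <= t^s q^t < e s^s q^t. *)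
rewrite -(ltr_pM2l (expR_gt0 1)).
apply: (@le_lt_trans _ _ (s.+1%:R ^+ s * q%:R ^+ s.+1)).
  rewrite (_ : _ * _ = s.+1%:R ^+ s * ((cop_number G)%:R * (expR 1 * s.+1%:R))).
    by rewrite ler_wpM2l // exprn_ge0.
  by rewrite exprS; ring.
by rewrite mulrA ltr_pM2r // expS_lt_expR1.
Qed.
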